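(* Let $\epsilon\in[0,2]$. Then the subdivision scheme $S_\epsilon$ reproduces the space $\Pi_2$ of real polynomials of degree at most $2$. That is, for every $F\in\Pi_2$, if $f^0_i=F(i)$ for all $i\in\mathbb{Z}$ and $f^{k+1}=S_\epsilon f^k$ for $k\ge 0$, then $S_\epsilon^\infty f^0=F$.
   Context: For a parameter $\epsilon$, define $\Gamma_\epsilon:\mathbb{R}^4\to\mathbb{R}$ by $$\Gamma_\epsilon(f_{-1},f_0,f_1,f_2)=\begin{cases}\dfrac12\,\dfrac{1}{\left(1+\sqrt{1+\frac{f_2-f_{-1}}{f_1-f_0}}\right)^2-1}, & f_1\ne f_0 \text{ and } 1+\frac{f_2-f_{-1}}{f_1-f_0}\ge \epsilon^2,\\[4pt] 0, & f_{-1}\le f_0=f_1\le f_2 \text{ or } f_{-1}\ge f_0=f_1\ge f_2,\\[2pt] \frac1{16}, & \text{otherwise.}\end{cases}$$ (For $\epsilon=0$ the first case is used only where its denominator is nonzero.) The interpolatory, stationary binary scheme $S_\epsilon$ acts on real sequences $f=(f_i)_{i\in\mathbb{Z}}$ by $$(S_\epsilon f)_{2i}=f_i,\qquad (S_\epsilon f)_{2i+1}=\tfrac12 f_i+\tfrac12 f_{i+1}-\Gamma_\epsilon(f_{i-1},f_i,f_{i+1},f_{i+2})\,(f_{i+2}-f_{i+1}-f_i+f_{i-1}).$$ For an initial sequence $f^0$ and a continuous function $G:\mathbb{R}\to\mathbb{R}$, $S_\epsilon^\infty f^0=G$ means that the iterates $f^{k+1}=S_\epsilon f^k$ satisfy $\lim_{k\to\infty}\sup_{i\in\mathbb{Z}}|f^k_i-G(i2^{-k})|=0$.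 Since the rules are local, they are applied to arbitrary (possibly unbounded) real sequences. *)

(* Defs.v *)
(* Subdivision scheme over the reals, in MathComp-Analysis. *)
From HB Require Import structures.
From mathcomp Require Import all_boot all_order all_algebra.
From mathcomp Require Import all_classical all_reals all_analysis.

Set Implicit Arguments.
Unset Strict Implicit.
Unset Printing Implicit Defensive.

Import Order.TTheory GRing.Theory Num.Theory.
Import numFieldNormedType.Exports.

Local Open Scope classical_set_scope.
Local Open Scope ring_scope.

Definition Gamma_den (R : realType) (fm1 f0 f1 f2 : R) : R :=
  (1 + Num.sqrt (1 + (f2 - fm1) / (f1 - f0))) ^+ 2 - 1.

(* The test [Gamma_den != 0] matters only for [eps = 0]: if [eps != 0], the
   square root is positive under the second test and [Gamma_den > 0]. When it
   fails, [f1 != f0], so the value is [1 / 16]. *)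
Definition Gamma (R : realType) (eps fm1 f0 f1 f2 : R) : R :=
  if [&& f1 != f0, eps ^+ 2 <= 1 + (f2 - fm1) / (f1 - f0)
       & Gamma_den fm1 f0 f1 f2 != 0]
  then 1 / 2 * (1 / Gamma_den fm1 f0 f1 f2)
  else if [&& fm1 <= f0, f0 == f1 & f1 <= f2]
          || [&& f0 <= fm1, f0 == f1 & f2 <= f1]
  then 0
  else 1 / 16.

(* [%/] on [int] rounds down when dividing by [2], so [j] is [2 * i] or
   [2 * i + 1] for negative [j] as well. *)
Definition subdiv (R : realType) (eps : R) (f : int -> R) : int -> R :=
  fun j =>
    let i := (j %/ 2)%Z in
    if (2 %| j)%Z then f i
    else 1 / 2 * f i + 1 / 2 * f (i + 1)
         - Gamma eps (f (i - 1)) (f i) (f (i + 1)) (f (i + 2))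
           * (f (i + 2) - f (i + 1) - f i + f (i - 1)).

(* The supremum is taken in the extended reals because the sequences may be
   unbounded. *)
Definition subdiv_limit (R : realType) (eps : R) (f0 : int -> R) (G : R -> R) :
    Prop :=
  continuous G /\
  (fun k : nat => ereal_sup
     [set `|iter k (subdiv eps) f0 i - G (i%:~R / 2 ^+ k)|%:E | i in [set: int]])
    @ \oo --> 0%E.

(* Main.v *)
(* On samples of a quadratic polynomial at four equidistant points, the third
   difference [f2 - f_{-1} - 3 (f1 - f0)] vanishes. If [f1 != f0], the quotient
   in [Gamma] is thus [3] and [Gamma = 1 / 16], the weight of the four-point
   scheme that is exact on cubics. If [f1 = f0], then [Gamma] is [1 / 16] as
   well, or it is [0] and all four samples agree, so that it multiplies [0].
   Hence every iterate is a sampling of the polynomial and the error is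
   identically [0]. *)
Require Import Defs.
From HB Require Import structures.
From mathcomp Require Import all_boot all_order all_algebra.
From mathcomp Require Import all_classical all_reals all_analysis.
From mathcomp Require Import ring lra zify.

Import Order.TTheory GRing.Theory Num.Theory.
Import numFieldNormedType.Exports.

Local Open Scope classical_set_scope.
Local Open Scope ring_scope.

Lemma Gamma_third_difference0 (R : realType) (eps fm1 f0 f1 f2 : R) :
  0 <= eps -> eps <= 2 -> f2 - fm1 = 3 * (f1 - f0) ->
  Gamma eps fm1 f0 f1 f2 * (f2 - f1 - f0 + fm1)
  = 1 / 16 * (f2 - f1 - f0 + fm1).
Proof.
move=> eps0 eps2 d3; rewrite /Gamma.
have [f10|f10] /= := eqVneq f1 f0.
  rewrite f10 subrr mulr0 in d3 *.
  (* Here [f2 = fm1], so a monotone run through [f0 = f1] is constant. *)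
  by case: ifP => // /orP[] /andP[h1 h2]; nra.
have q3 : (f2 - fm1) / (f1 - f0) = 3 by rewrite d3 mulfK // subr_eq0.
have den8 : Gamma_den fm1 f0 f1 f2 = 8.
  rewrite /Gamma_den q3.
  have -> : 1 + 3 = 2 ^+ 2 :> R by ring.
  by rewrite sqrtr_sqr ger0_norm //; ring.
(* The range of [eps] enters here, placing the quotient [3] in the first case of [Gamma]. *)
have eps4 : eps ^+ 2 <= 1 + 3 by nra.
by rewrite den8 q3 eps4 pnatr_eq0 /=; congr (_ * _); field.
Qed.

Lemma horner_size3 (R : nzSemiRingType) (F : {poly R}) (x : R) :
  (size F <= 3)%N -> F.[x] = F`_0 + F`_1 * x + F`_2 * x ^+ 2.
Proof.
move=> hF; rewrite (horner_coef_wide _ hF) !big_ord_recr big_ord0 /=.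
by rewrite add0r expr0 mulr1 expr1.
Qed.

(** The spacing [h] is arbitrary so that the lemma can be iterated. *)
Lemma subdiv_sample (R : realType) (eps h : R) (F : {poly R}) :
  0 <= eps -> eps <= 2 -> (size F <= 3)%N ->
  subdiv eps (fun i : int => F.[i%:~R * h])
  = (fun i : int => F.[i%:~R * (h / 2)]).
Proof.
move=> eps0 eps2 hF; apply/funext => j; rewrite /subdiv.
set i := (j %/ 2)%Z.
have jE : j = i * 2 + (j %% 2)%Z by exact: divz_eq.
have r_ge0 : 0 <= (j %% 2)%Z by exact: modz_ge0.
have r_lt2 : (j %% 2)%Z < 2 by exact: ltz_pmod.
case: ifPn => /dvdz_mod0P r0.
  rewrite r0 addr0 in jE.
  by rewrite jE rmorphM /=; congr (_.[_]); field.
have {}jE : j = i * 2 + 1 by lia.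
(* [field] closes two identities: the vanishing third difference, and exactness at the midpoint of
   the weights -1/16, 9/16, 9/16, -1/16. *)
by rewrite Gamma_third_difference0 // !(horner_size3 _ _ _ hF) ?jE
  !(rmorphD, rmorphN, rmorphM) /=; field.
Qed.

Lemma iter_subdiv_sample (R : realType) (eps : R) (F : {poly R}) (k : nat) :
  0 <= eps -> eps <= 2 -> (size F <= 3)%N ->
  iter k (subdiv eps) (fun i : int => F.[i%:~R])
  = (fun i : int => F.[i%:~R / 2 ^+ k]).
Proof.
move=> eps0 eps2 hF; elim: k => [|k IHk].
  by apply/funext => i; rewrite /= expr0 divr1.
by rewrite iterS IHk subdiv_sample // exprSr invfM.
Qed.

Theorem proposition11 (R : realType) (eps : R) (heps0 : 0 <= eps)
    (heps2 : eps <= 2) (F : {poly R}) (hF : (size F <= 3)%N) :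
  subdiv_limit eps (fun i : int => F.[i%:~R]) (fun x : R => F.[x]).
Proof.
split; first exact: continuous_horner.
apply: (@cvg_trans _ (cst 0%E @ \oo)); last exact: cvg_cst.
apply: near_eq_cvg; apply: nearW => k /=.
rewrite iter_subdiv_sample //.
rewrite (_ : [set _ | _ in _] = [set 0%E]) ?ereal_sup1 //.
apply/seteqP; split => [_ [i _ <-]|_ ->] /=; first by rewrite subrr normr0.
(* An index is needed: the supremum of an empty set is [-oo]. *)
by exists 0; rewrite // subrr normr0.
Qed.
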